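(* Suppose that every $\phi_i$, $i\in[n]$, is $L_i$-smooth (in the sense given in the context) and that the average of the $n$ loss functions $\frac1n\sum_{i=1}^n\phi_i(w^Tx_i)$ is convex as a function of $w$ (individual $\phi_i$ may be nonconvex). Let $\bar\gamma=\frac1n\sum_{i=1}^nL_i^2$, and run adfSDCA (described in the context), where at every iteration $t\ge0$ the probability vector is $p^{(t)}=p^*$ with $$p_i^{*}=\frac{\sqrt{v_i\bar\gamma+n\lambda^2}\,|\kappa_i^{(t)}|}{\sum_{j\in I_{\kappa^{(t)}}}\sqrt{v_j\bar\gamma+n\lambda^2}\,|\kappa_j^{(t)}|},\qquad i\in[n],$$ and the step size $\theta^{(t)}\in(0,1)$ is $$\theta^{(t)}=\frac{n\lambda^2\sum_{i\in I_{\kappa^{(t)}}}(\kappa_i^{(t)})^2}{\big(\sum_{i\in I_{\kappa^{(t)}}}\sqrt{v_i\bar\gamma+n\lambda^2}\,|\kappa_i^{(t)}|\big)^2}.$$ Then at every iteration $t\ge0$, $$\mathbf E[\bar D^{(t+1)}\mid\alpha^{(t)}]\le(1-\theta^* )\bar D^{(t)},\qquad\text{where}\quad\theta^*=\frac{n\lambda^2}{\sum_{i=1}^n(v_i\bar\gamma+n\lambda^2)}\le\theta^{(t)}.$$ Furthermore, for $\epsilon>0$, if $$T\ge\Big(n+\frac{\bar\gamma Q}{\lambda^2}\Big)\log\Big(\frac{(\lambda+L)\bar C_0}{2\bar\gamma\epsilon}\Big),$$ then $\mathbf E[P(w^{(T)})-P(w^* )]\le\epsilon$.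
   Context: Setting. $[n]=\{1,\dots,n\}$; $x_1,\dots,x_n\in\mathbb R^d$; $\lambda>0$; $\phi_1,\dots,\phi_n:\mathbb R\to\mathbb R$ are differentiable. $P(w)=\frac1n\sum_{i=1}^n\phi_i(w^Tx_i)+\frac\lambda2\|w\|^2$ for $w\in\mathbb R^d$. Standing assumption: each $\phi_i$ is $\tilde L_i$-smooth with $\tilde L_i>0$, i.e. $|\phi_i'(\beta)-\phi_i'(\beta+\delta)|\le\tilde L_i|\delta|$ for all $\beta,\delta\in\mathbb R$. ''$\phi_i$ is $L_i$-smooth'' means that the function $w\mapsto\phi_i(x_i^Tw)$ on $\mathbb R^d$ is $L_i$-smooth, i.e. its gradient is $L_i$-Lipschitz, $\|\nabla\phi_i(x_i^Tw)-\nabla\phi_i(x_i^T\bar w)\|\le L_i\|w-\bar w\|$ for all $w,\bar w\in\mathbb R^d$, where $L_i\le\|x_i\|^2\tilde L_i$. $L=\max_iL_i$, $v_i=\|x_i\|^2$, $Q=\frac1n\sum_{i=1}^nv_i$. $w^*$ is the minimizer of $P$ and $\alpha^*\in\mathbb R^n$ is given by $\alpha_i^*=-\phi_i'(x_i^Tw^* )$. adfSDCA. Choose $\alpha^{(0)}\in\mathbb R^n$ and set $w^{(0)}=\frac1{\lambda n}\sum_{i}\alpha_i^{(0)}x_i$. At iteration $t=0,1,2,\dots$: compute the dual residue $\kappa_i^{(t)}=\alpha_i^{(t)}+\phi_i'(x_i^Tw^{(t)})$ for all $i\in[n]$; sample a coordinate $i\in[n]$ according to a probability vector $p^{(t)}$;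 set $\alpha_i^{(t+1)}=\alpha_i^{(t)}-\theta^{(t)}(p_i^{(t)})^{-1}\kappa_i^{(t)}$, $\alpha_j^{(t+1)}=\alpha_j^{(t)}$ for $j\ne i$, and $w^{(t+1)}=w^{(t)}-\theta^{(t)}(n\lambda p_i^{(t)})^{-1}\kappa_i^{(t)}x_i$. For $\kappa\in\mathbb R^n$, $I_\kappa=\{i\in[n]:\kappa_i\ne0\}$; the formulas for $p^*$ and $\theta^{(t)}$ presuppose $\kappa^{(t)}\ne0$. Potential. $\bar D^{(t)}=\frac1n\|\alpha^{(t)}-\alpha^*\|^2+\bar\gamma\|w^{(t)}-w^*\|^2$ and $\bar C_0=\bar D^{(0)}$. $\log$ is the natural logarithm.
   Formalization: The formal theorem also assumes |φ_i'(x_i^T w) − φ_i'(x_i^T w')| ≤ L_i‖w−w'‖ for all i, w, w' (not implied by L_i-smoothness if 0<‖x_i‖<1; the claim fails for n=d=1, x=λ=1/10, φ(b)=50b²), and takes γ̄>0 in the bound on T. *)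

(* Defs.v *)
From HB Require Import structures.
From mathcomp Require Import all_boot all_order all_algebra.
From mathcomp Require Import all_classical all_reals all_analysis.

Set Implicit Arguments.
Unset Strict Implicit.
Unset Printing Implicit Defensive.

Import Order.TTheory GRing.Theory Num.Theory.
Import numFieldNormedType.Exports.
Local Open Scope classical_set_scope.
Local Open Scope ring_scope.

(* Vectors are row vectors.  The library norm [`|u|] on matrices is the sup
   norm, hence the separate Euclidean norm. *)
Definition dotp (R : realType) (d : nat) (u v : 'rV[R]_d) : R :=
  \sum_j u 0 j * v 0 j.

Definition enorm (R : realType) (d : nat) (u : 'rV[R]_d) : R :=
  Num.sqrt (dotp u u).

Definition grad (R : realType) (d : nat) (f : 'rV[R]_d -> R) (w : 'rV[R]_d) :
    'rV[R]_d :=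
  \row_j 'd f w (delta_mx 0 j).

Definition smooth (R : realType) (d : nat) (L : R) (f : 'rV[R]_d -> R) : Prop :=
  (forall w, differentiable f w) /\
  (forall w w', enorm (grad f w - grad f w') <= L * enorm (w - w')).

Section Objective.
Context (R : realType) (n d : nat).
Variables (x : 'I_n -> 'rV[R]_d) (phi : 'I_n -> R -> R).

Definition avg_loss (w : 'rV[R]_d) : R :=
  n%:R^-1 * \sum_i phi i (dotp w (x i)).

Definition primal (lambda : R) (w : 'rV[R]_d) : R :=
  avg_loss w + lambda / 2 * enorm w ^+ 2.

Definition alpha_opt (wopt : 'rV[R]_d) : 'rV[R]_n :=
  \row_i - derive1 (phi i) (dotp (x i) wopt).

Definition residue (a : 'rV[R]_n) (w : 'rV[R]_d) : 'rV[R]_n :=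
  \row_i (a 0 i + derive1 (phi i) (dotp (x i) w)).

Definition vnorm2 (i : 'I_n) : R := enorm (x i) ^+ 2.

Definition Qavg : R := n%:R^-1 * \sum_i vnorm2 i.

Definition gamma_bar (Ls : 'I_n -> R) : R := n%:R^-1 * \sum_i Ls i ^+ 2.

(* The default value 0 is harmless: smoothness constants are nonnegative. *)
Definition Lmax (Ls : 'I_n -> R) : R := \big[Num.max/0]_i Ls i.

Definition potential (gamma : R) (wopt : 'rV[R]_d)
    (a : 'rV[R]_n) (w : 'rV[R]_d) : R :=
  n%:R^-1 * enorm (a - alpha_opt wopt) ^+ 2 + gamma * enorm (w - wopt) ^+ 2.

Definition weight (lambda gamma : R) (i : 'I_n) : R :=
  vnorm2 i * gamma + n%:R * lambda ^+ 2.

(* Only meaningful when [kappa != 0], like [theta_of]. *)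
Definition pstar (lambda gamma : R) (kappa : 'rV[R]_n) : 'rV[R]_n :=
  \row_i (Num.sqrt (weight lambda gamma i) * `|kappa 0 i| /
          \sum_(j | kappa 0 j != 0)
             Num.sqrt (weight lambda gamma j) * `|kappa 0 j|).

Definition theta_of (lambda gamma : R) (kappa : 'rV[R]_n) : R :=
  n%:R * lambda ^+ 2 * (\sum_(i | kappa 0 i != 0) kappa 0 i ^+ 2) /
  (\sum_(i | kappa 0 i != 0)
      Num.sqrt (weight lambda gamma i) * `|kappa 0 i|) ^+ 2.

Definition theta_star (lambda gamma : R) : R :=
  n%:R * lambda ^+ 2 / \sum_i weight lambda gamma i.

Definition w_init (lambda : R) (a : 'rV[R]_n) : 'rV[R]_d :=
  (lambda * n%:R)^-1 *: \sum_i a 0 i *: x i.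

(* [idx t] is the coordinate sampled at iteration [t]; it is drawn, given the
   past, from the random probability vector [p t].  The past up to iteration
   [t] is the value of [(idx 0, ..., idx (t - 1))], so [adf_sampling] is the
   product form of P(idx t = i | past) = p_i^(t), stated at the past of each
   outcome [o]. *)
Record adfSDCA_run (lambda : R) (dsp : measure_display)
    (Omega : measurableType dsp) (P : probability Omega R)
    (alpha0 : 'rV[R]_n) (idx : nat -> Omega -> 'I_n)
    (p : nat -> Omega -> 'rV[R]_n) (theta : nat -> Omega -> R)
    (alpha : nat -> Omega -> 'rV[R]_n) (w : nat -> Omega -> 'rV[R]_d) : Prop :=
  AdfSDCARun {
  adf_alpha0 : forall o, alpha 0 o = alpha0 ;
  adf_w0 : forall o, w 0 o = w_init lambda alpha0 ;
  adf_alphaS : forall t o (i := idx t o),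
    alpha t.+1 o = alpha t o -
      (theta t o * (p t o 0 i)^-1 * residue (alpha t o) (w t o) 0 i)
        *: delta_mx 0 i ;
  adf_wS : forall t o (i := idx t o),
    w t.+1 o = w t o -
      (theta t o * (n%:R * lambda * p t o 0 i)^-1 *
        residue (alpha t o) (w t o) 0 i) *: x i ;
  adf_measurable : forall t i, measurable (idx t @^-1` [set i]) ;
  adf_prob : forall t o, (forall i, 0 <= p t o 0 i) /\ \sum_i p t o 0 i = 1 ;
  adf_sampling : forall t o i,
    P ([set o' | forall s, (s < t)%N -> idx s o' = idx s o] `&`
       idx t @^-1` [set i]) =
    (P [set o' | forall s, (s < t)%N -> idx s o' = idx s o] *
      (p t o 0 i)%:E)%E }.

End Objective.

(* E[X | Y] for a random element [Y] with finitely many values: at an outcome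
   [o], the average of [X] over the event {Y = Y o}.  When that event is null
   the value is junk, which is immaterial almost everywhere. *)
Definition cond_expectation (R : realType) (dsp : measure_display)
    (Omega : measurableType dsp) (P : probability Omega R) (T : Type)
    (X : Omega -> R) (Y : Omega -> T) (o : Omega) : \bar R :=
  (((fine (P (Y @^-1` [set Y o])))^-1)%:E *
   \int[P]_(o' in Y @^-1` [set Y o]) (X o')%:E)%E.

(* Main.v *)
Require Import Defs.
From HB Require Import structures.
From mathcomp Require Import all_boot all_order all_algebra.
From mathcomp Require Import all_classical all_reals all_analysis.
From mathcomp Require Import measurable_realfun ring lra.

Set Implicit Arguments.
Unset Strict Implicit.
Unset Printing Implicit Defensive.

Import Order.TTheory GRing.Theory Num.Theory.
Import numFieldNormedType.Exports.
Local Open Scope classical_set_scope.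
Local Open Scope ring_scope.

(* Write kappa_i = A_i + B_i with A = alpha - alpha_opt and
   B_i = phi_i'(x_i^T w) - phi_i'(x_i^T wopt).  In the expected decrease of the
   potential, 2 kappa_i A_i = kappa_i^2 + A_i^2 - B_i^2, the terms B_i^2 are
   bounded by smoothness, and (1/n) sum_i kappa_i x_i is the gradient of P at w
   (by the invariant w = (1/(lambda n)) sum_i alpha_i x_i), which is strongly
   monotone.  The choice of pstar and theta cancels the remaining terms in
   kappa^2, leaving the factor 1 - theta; Cauchy-Schwarz gives
   theta_star <= theta.  If kappa = 0, then w is stationary, so the potential
   already vanishes.  The iterates are functions of the finitely many sampled
   histories, so all expectations are finite sums. *)

(** * Euclidean inner product and norm *)

Section Euclidean.
Context (R : realType) (d : nat).
Implicit Types u v w : 'rV[R]_d.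

Lemma dotpC u v : dotp u v = dotp v u.
Proof. by apply: eq_bigr => j _; rewrite mulrC. Qed.

Lemma dotpDr u v w : dotp u (v + w) = dotp u v + dotp u w.
Proof.
by rewrite /dotp -big_split; apply: eq_bigr => j _; rewrite mxE mulrDr.
Qed.

Lemma dotpZr a u v : dotp u (a *: v) = a * dotp u v.
Proof.
by rewrite /dotp mulr_sumr; apply: eq_bigr => j _; rewrite mxE; ring.
Qed.

Lemma dotpNr u v : dotp u (- v) = - dotp u v.
Proof. by rewrite -scaleN1r dotpZr mulN1r. Qed.

Lemma dotpBr u v w : dotp u (v - w) = dotp u v - dotp u w.
Proof. by rewrite dotpDr dotpNr. Qed.

Lemma dotp_sumr u I (r : seq I) (F : I -> 'rV[R]_d) :
  dotp u (\sum_(i <- r) F i) = \sum_(i <- r) dotp u (F i).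
Proof.
elim/big_rec2: _ => [|i a b _ <-]; last by rewrite dotpDr.
by rewrite -(scale0r 0) dotpZr mul0r.
Qed.

Lemma dotp_delta u i : dotp u (delta_mx 0 i) = u 0 i.
Proof.
rewrite /dotp (bigD1 i)//= big1 ?addr0 => [|j ji]; rewrite mxE ?eqxx ?mulr1//=.
by rewrite (negbTE ji) mulr0.
Qed.

Lemma dotp_ge0 u : 0 <= dotp u u.
Proof. by apply: sumr_ge0 => j _; rewrite -expr2 sqr_ge0. Qed.

Lemma dotp_eq0 u : dotp u u = 0 -> u = 0.
Proof.
move=> u0; apply/rowP => j; rewrite mxE; apply/eqP.
rewrite -sqrf_eq0 expr2; apply/eqP; move: j (erefl true).
apply/psumr_eq0P => //.
by move=> j _; rewrite -expr2 sqr_ge0.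
Qed.

Lemma enorm_ge0 u : 0 <= enorm u.
Proof. exact: sqrtr_ge0. Qed.

Lemma sqr_enorm u : enorm u ^+ 2 = dotp u u.
Proof. by rewrite sqr_sqrtr ?dotp_ge0. Qed.

Lemma enormZ a u : enorm (a *: u) = `|a| * enorm u.
Proof.
rewrite /enorm dotpZr (dotpC (a *: u)) dotpZr mulrA -expr2.
by rewrite sqrtrM ?sqr_ge0// sqrtr_sqr.
Qed.

End Euclidean.

(** With [A], [B], [C] as set in the proof, the sum of the squares of [B f - C g] expands to
    [B (A B - C^2)]. If [B = 0], then [g] vanishes. *)
Lemma cauchy_schwarz_sum (R : realFieldType) (I : finType) (f g : I -> R) :
  (\sum_i f i * g i) ^+ 2 <= (\sum_i f i ^+ 2) * (\sum_i g i ^+ 2).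
Proof.
set C := \sum_i _; set A := \sum_i _; set B := \sum_i _.
have B0 : 0 <= B by apply: sumr_ge0 => i _; exact: sqr_ge0.
have : 0 <= \sum_i (B * f i - C * g i) ^+ 2.
  by apply: sumr_ge0 => i _; exact: sqr_ge0.
have -> : \sum_i (B * f i - C * g i) ^+ 2 = B * (A * B - C ^+ 2).
  transitivity (B ^+ 2 * A - 2 * B * C * C + C ^+ 2 * B); last by ring.
  rewrite [B ^+ 2 * A]mulr_sumr [_ * C * C]mulr_sumr [C ^+ 2 * B]mulr_sumr.
  by rewrite -sumrB -big_split; apply: eq_bigr => i _ /=; ring.
have [B1|B1 _] := ltP 0 B; first by rewrite pmulr_rge0// subr_ge0.
have gE i : g i = 0.
  apply/eqP; rewrite -sqrf_eq0; apply/eqP; move: i (erefl true).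
  apply/psumr_eq0P => [i _|]; first exact: sqr_ge0.
  by apply/eqP; rewrite eq_le B1.
rewrite /C big1 => [|i _]; last by rewrite gE mulr0.
by rewrite expr0n mulr_ge0//; apply: sumr_ge0 => i _; exact: sqr_ge0.
Qed.

Lemma dotp_le_enorm (R : realType) (d : nat) (u v : 'rV[R]_d) :
  `|dotp u v| <= enorm u * enorm v.
Proof.
rewrite -(@ler_pXn2r _ 2)// ?nnegrE ?mulr_ge0 ?enorm_ge0//.
rewrite exprMn real_normK ?num_real// !sqr_enorm.
by rewrite (le_trans (cauchy_schwarz_sum _ _)).
Qed.

(** * One-variable calculus along a line *)

Section Line.
Context (R : realType).

Lemma is_derive_line (f : R -> R) (a b s : R) : (forall y, derivable f y 1) ->
  is_derive s 1 (fun s => f (a + s * b)) (derive1 f (a + s * b) * b).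
Proof.
move=> df.
have fD : is_derive (a + s * b) 1 f (derive1 f (a + s * b)).
  by rewrite derive1E; exact/derivableP/df.
have gD : is_derive s 1 (fun s => a + s * b) b.
  apply: is_derive_eq; rewrite /GRing.scale/=; ring.
exact (@is_derive1_comp R f (fun s => a + s * b) s _ _ fD gD).
Qed.

(** The difference quotients from the right are at most [c], hence so is their limit. This turns
    convexity and minimality into inequalities between derivatives. *)
Lemma secant_bound (f : R -> R) (m c : R) : is_derive (0 : R) 1 f m ->
  (forall s, 0 < s -> s <= 1 -> f s <= f 0 + s * c) -> m <= c.
Proof.
move=> [df <-] fc.
apply: (@cvgr_to_le _ (at_right (0 : R)) _ _
  (fun h => h^-1 *: (f (h *: 1 + 0) - f 0))).
  (* Approaching 0 from the right refines the punctured neighbourhoods that define the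
     derivative. *)
  apply: cvg_trans df; apply: cvg_app => A.
  change ((\forall y \near (0 : R), y != 0 -> A y) ->
          \forall y \near (0 : R), 0 < y -> A y).
  by apply: filterS => y Ay y0; apply: Ay; rewrite gt_eqF.
near=> h.
have h0 : 0 < h by near: h; exact: nbhs_right_gt.
have h1 : h <= 1 by near: h; apply: nbhs_right_le.
rewrite /GRing.scale/= mulr1 addr0 ler_pdivrMl//.
have := fc h h0 h1; lra.
Unshelve. all: by end_near. Qed.

(** Mean value theorem for [f (a + s b)] minus its linear part in [s] and [K s^2 / 2]: the
    derivative is nonpositive on [0, 1]. The factor 1/2 comes out without integration. *)
Lemma descent (f : R -> R) (a b K : R) : (forall y, derivable f y 1) ->
  (forall s, 0 <= s -> s <= 1 ->
     (derive1 f (a + s * b) - derive1 f a) * b <= K * s) ->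
  f (a + b) - f a <= derive1 f a * b + K / 2.
Proof.
move=> df fK.
pose h (s : R) := f (a + s * b) + - (derive1 f a * b * s + K / 2 * (s * s)).
pose dh (s : R) := derive1 f (a + s * b) * b - (derive1 f a * b + K * s).
have hD s : is_derive s (1 : R) h (dh s).
  apply: is_deriveD; first exact: is_derive_line.
  apply: is_deriveN; apply: is_derive_eq.
  rewrite /GRing.scale/=; lra.
have hc : {within `[(0 : R), 1], continuous h}.
  apply: continuous_subspaceT => s.
  exact/differentiable_continuous/derivable1_diffP.
have [c /andP[c0 c1]] := MVT_segment ler01 (fun s _ => hD s) hc.
rewrite !bnd_simp in c0 c1.
have := fK c c0 c1.
rewrite /h /dh mul0r mul1r addr0 !mulr0 !mulr1; lra.
Qed.
End Line.

(** * The primal objective: convexity, stationarity, smoothness *)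

Section Problem.
Context (R : realType) (n d : nat).
Variables (x : 'I_n -> 'rV[R]_d) (phi : 'I_n -> R -> R).
Hypothesis phi_diff : forall i (b : R), derivable (phi i) b 1.

(** The derivative of [avg_loss] at [w] in the direction [u], as given by the chain rule. *)
Definition slope (w u : 'rV[R]_d) : R :=
  n%:R^-1 * \sum_i derive1 (phi i) (dotp (x i) w) * dotp (x i) u.

Lemma slopeN w u : slope w (- u) = - slope w u.
Proof.
rewrite /slope -mulrN -sumrN; congr (_ * _).
by apply: eq_bigr => i _; rewrite dotpNr mulrN.
Qed.

Lemma is_derive_avg_loss w u :
  is_derive (0 : R) 1 (fun s => avg_loss x phi (w + s *: u)) (slope w u).
Proof.
pose h i s := phi i (dotp (x i) w + s * dotp (x i) u).
have -> : (fun s => avg_loss x phi (w + s *: u)) = n%:R^-1 \*: \sum_i h i.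
  apply/funext => s; rewrite /avg_loss /= fct_sumE; congr (_ * _).
  by apply: eq_bigr => i _; rewrite dotpC dotpDr dotpZr.
apply: is_deriveZ; apply: is_derive_sum => i.
have := is_derive_line (dotp (x i) w) (dotp (x i) u) 0 (@phi_diff i).
by rewrite mul0r addr0 => H; exact H.
Qed.

Lemma is_derive_primal lambda w u :
  is_derive (0 : R) 1 (fun s => primal x phi lambda (w + s *: u))
    (slope w u + lambda * dotp w u).
Proof.
have -> : (fun s => primal x phi lambda (w + s *: u)) =
    (fun s => avg_loss x phi (w + s *: u) +
      (lambda / 2 * dotp w w + (lambda * dotp w u * s
         + lambda / 2 * dotp u u * (s * s)))).
  apply/funext => s; rewrite /primal sqr_enorm; congr (_ + _).
  rewrite dotpDr !(dotpC (w + _)) !dotpDr !dotpZr !(dotpC (s *: _)) !dotpZr.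
  by field.
apply: is_deriveD; first exact: is_derive_avg_loss.
apply: is_derive_eq; rewrite /GRing.scale/=; ring.
Qed.

Lemma convex_segment (f : 'rV[R]_d -> R) w u s :
  convex_function [set: convex_lmodType 'rV[R]_d] f -> 0 < s -> s <= 1 ->
  f (w + s *: u) <= f w + s * (f (w + u) - f w).
Proof.
move=> fconv s0 s1.
have s01 : Itv.spec (@Itv.num_sem R) (Itv.Real `[0%Z, 1%Z]) s.
  by rewrite /= /Itv.num_sem/= num_real/= in_itv/= (ltW s0).
have := fconv (Itv.mk s01) (w + u) w (mem_setT _) (mem_setT _).
rewrite convRE /unstable.onem /=.
have -> : conv (Itv.mk s01) (w + u : convex_lmodType 'rV[R]_d) w =
   s *: (w + u) + (1 - s) *: w by [].
have -> : s *: (w + u) + (1 - s) *: w = w + s *: u.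
  by rewrite scalerDr scalerBl scale1r addrC addrA subrK.
by move=> /le_trans; apply; lra.
Qed.

(** By convexity the increment of [avg_loss] from [w] to [w + u] lies between the two slopes: take
    secants at [w] along [u], and at [w + u] along [- u]. *)
Lemma slope_monotone w u :
  convex_function [set: convex_lmodType 'rV[R]_d] (avg_loss x phi) ->
  slope w u <= slope (w + u) u.
Proof.
move=> cf; rewrite -[leRHS]opprK -slopeN lerNr.
apply: (@le_trans _ _ (- (avg_loss x phi (w + u) - avg_loss x phi w))).
  apply: (secant_bound (is_derive_avg_loss _ _)) => s s0 s1.
  have := convex_segment (w + u) (- u) cf s0 s1.
  by rewrite scale0r addr0 addrK opprB.
rewrite lerN2; apply: (secant_bound (is_derive_avg_loss _ _)) => s s0 s1.
by have := convex_segment w u cf s0 s1; rewrite scale0r addr0.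
Qed.

(** At a minimizer every directional derivative is nonnegative; apply this to [u] and to [- u]. *)
Lemma primal_stationary lambda wopt u :
  (forall w, primal x phi lambda wopt <= primal x phi lambda w) ->
  slope wopt u + lambda * dotp wopt u = 0.
Proof.
move=> wmin.
suff ge0 v : 0 <= slope wopt v + lambda * dotp wopt v.
  apply/eqP; rewrite eq_le ge0 andbT.
  by have := ge0 (- u); rewrite slopeN dotpNr mulrN -opprD oppr_ge0.
rewrite -[leLHS]opprK lerNl.
have dP := is_derive_primal lambda wopt v.
apply: (secant_bound (is_deriveN dP)) => s _ _ /=.
by rewrite !opprfctE oppr0 mulr0 scale0r !addr0 lerN2.
Qed.

(** The average loss has monotone slopes, the regularizer contributes [lambda * dotp u u], and the
    derivative at [wopt] is zero. *)
Lemma primal_strong_monotone lambda wopt w (u := w - wopt) :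
  convex_function [set: convex_lmodType 'rV[R]_d] (avg_loss x phi) ->
  (forall w, primal x phi lambda wopt <= primal x phi lambda w) ->
  lambda * dotp u u <= slope w u + lambda * dotp w u.
Proof.
move=> cf wmin.
have wE : w = wopt + u by rewrite addrC subrK.
have := slope_monotone wopt u cf; rewrite -wE.
have := primal_stationary u wmin.
have -> : dotp w u = dotp wopt u + dotp u u.
  by rewrite {1}wE dotpC dotpDr dotpC.
lra.
Qed.

Lemma grad_glm i w : differentiable (fun w => phi i (dotp (x i) w)) w ->
  grad (fun w => phi i (dotp (x i) w)) w =
  derive1 (phi i) (dotp (x i) w) *: x i.
Proof.
move=> df; apply/rowP => j; rewrite !mxE -deriveE//.
have := is_derive_line (dotp (x i) w) (dotp (x i) (delta_mx 0 j)) 0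
  (@phi_diff i).
rewrite mul0r addr0 dotp_delta => -[_ <-]; rewrite /derive.
(* Both derivatives are limits of one quotient: moving [w] along a basis vector moves [dotp (x i) w]
   along a line. *)
apply: (congr1 (fun F : R -> R => lim (F @ (0 : R)^'))).
apply/funext => h; congr (_ *: (phi i _ - phi i _)).
  by rewrite dotpDr dotpZr dotp_delta addrC /GRing.scale/= mulr1 addr0.
by rewrite mul0r addr0.
Qed.

(** [descent] is applied to each [phi i] from [wopt] and averaged. Stationarity cancels the linear
    terms with those of the regularizer, so only quadratic terms remain. *)
Lemma primal_gap (lambda : R) (Ls : 'I_n -> R) wopt w :
  (0 < n)%N ->
  (forall i, smooth (Ls i) (fun w => phi i (dotp (x i) w))) ->
  (forall w, primal x phi lambda wopt <= primal x phi lambda w) ->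
  primal x phi lambda w - primal x phi lambda wopt <=
  (lambda + Lmax Ls) / 2 * enorm (w - wopt) ^+ 2.
Proof.
move=> n0 sm wmin; set u := w - wopt.
have wE : w = wopt + u by rewrite addrC subrK.
clearbody u.
have Li i : phi i (dotp (x i) w) - phi i (dotp (x i) wopt) <=
    derive1 (phi i) (dotp (x i) wopt) * dotp (x i) u
      + Lmax Ls * enorm u ^+ 2 / 2.
  rewrite {1}wE dotpDr; apply: descent => // s s0 _.
  have [df gl] := sm i.
  (* The gradients differ by a multiple of [x i], so smoothness bounds [|a|] times the norm of [x i]
     by [Ls i] times [s] times the norm of [u]. This allows [K = Lmax Ls * enorm u ^+ 2] in
     [descent]. *)
  have := gl (wopt + s *: u) wopt.
  rewrite !grad_glm// -scalerBl addrAC subrr add0r !enormZ dotpDr dotpZr.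
  rewrite (ger0_norm s0) => gL.
  set a := (_ - _) in gL *.
  have aE : a * dotp (x i) u <= `|a| * (enorm (x i) * enorm u).
    rewrite (le_trans (ler_norm _))// normrM ler_wpM2l//.
    exact: dotp_le_enorm.
  apply: (le_trans aE); rewrite mulrA.
  apply: (@le_trans _ _ (Ls i * (s * enorm u) * enorm u)).
    by rewrite ler_wpM2r// enorm_ge0.
  have -> : Ls i * (s * enorm u) * enorm u = Ls i * (s * enorm u ^+ 2) by ring.
  have -> : Lmax Ls * enorm u ^+ 2 * s = Lmax Ls * (s * enorm u ^+ 2) by ring.
  by rewrite ler_wpM2r ?mulr_ge0 ?enorm_ge0//; exact: le_bigmax.
have avgL : avg_loss x phi w - avg_loss x phi wopt <=
    slope wopt u + Lmax Ls * enorm u ^+ 2 / 2.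
  have nn : (n%:R : R) != 0 by rewrite pnatr_eq0 -lt0n.
  have -> : Lmax Ls * enorm u ^+ 2 / 2 =
      n%:R^-1 * \sum_(i < n) Lmax Ls * enorm u ^+ 2 / 2.
    rewrite sumr_const card_ord -[X in _ = _ * X]mulr_natl.
    by rewrite mulrA mulVf// mul1r.
  rewrite -mulrBr -mulrDr ler_wpM2l ?invr_ge0//.
  rewrite -sumrB -big_split; apply: ler_sum => i _ /=.
  by rewrite !(dotpC _ (x i)).
have := primal_stationary u wmin.
move: avgL; rewrite /primal !sqr_enorm.
have -> : dotp w w = dotp wopt wopt + 2 * dotp wopt u + dotp u u.
  by rewrite wE dotpDr !(dotpC (_ + _)) !dotpDr (dotpC u wopt); ring.
lra.
Qed.

End Problem.

(** * One iteration: bounds on the step size and expected decrease of the potential *)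

Section Step.
Context (R : realType) (n d : nat).
Variables (x : 'I_n -> 'rV[R]_d) (phi : 'I_n -> R -> R).
Variables (lambda gamma : R).
Hypotheses (lambda_gt0 : 0 < lambda) (gamma_ge0 : 0 <= gamma).
Hypothesis n_gt0 : (0 < n)%N.
Implicit Types (a kappa p : 'rV[R]_n) (w u : 'rV[R]_d).

Let nn : 0 < n%:R :> R.
Proof. by rewrite ltr0n. Qed.

Lemma enorm_subZ_sqr m (u v : 'rV[R]_m) c :
  enorm (u - c *: v) ^+ 2 =
  enorm u ^+ 2 - 2 * c * dotp u v + c ^+ 2 * enorm v ^+ 2.
Proof.
rewrite !sqr_enorm dotpBr !(dotpC (u - _)) !dotpBr !(dotpC (c *: v)) !dotpZr.
by rewrite (dotpC (c *: v)) dotpZr; ring.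
Qed.

Lemma vnorm2_ge0 i : 0 <= vnorm2 x i.
Proof. exact: sqr_ge0. Qed.

Lemma weight_gt0 i : 0 < weight x lambda gamma i.
Proof.
by rewrite ltr_wpDl ?mulr_ge0 ?mulr_gt0 ?exprn_gt0 ?enorm_ge0.
Qed.

(** The normalizer of [pstar], summed over all indices since a zero residue contributes nothing. *)
Definition wabs_sum kappa : R :=
  \sum_i Num.sqrt (weight x lambda gamma i) * `|kappa 0 i|.

Lemma wabs_sumE kappa :
  \sum_(i | kappa 0 i != 0) Num.sqrt (weight x lambda gamma i) * `|kappa 0 i| =
  wabs_sum kappa.
Proof.
rewrite big_mkcond; apply: eq_bigr => i _; case: eqP => //= ->.
by rewrite normr0 mulr0.
Qed.

Lemma sqr_sumE kappa :
  \sum_(i | kappa 0 i != 0) kappa 0 i ^+ 2 = \sum_i kappa 0 i ^+ 2.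
Proof.
rewrite big_mkcond; apply: eq_bigr => i _.
by case: eqP => //= ->; rewrite expr0n.
Qed.

Lemma row_neq0 kappa : kappa != 0 -> exists i, kappa 0 i != 0.
Proof.
move=> k0; apply/existsP; rewrite -negb_forall; apply: contra k0.
by move=> /forallP k0; apply/eqP/rowP => i; rewrite mxE; apply/eqP.
Qed.

Lemma wabs_sum_gt0 kappa : kappa != 0 -> 0 < wabs_sum kappa.
Proof.
move=> /row_neq0[i ki]; rewrite /wabs_sum (bigD1 i)//= ltr_wpDr//.
  by apply: sumr_ge0 => j _; rewrite mulr_ge0 ?sqrtr_ge0.
by rewrite mulr_gt0 ?sqrtr_gt0 ?weight_gt0 ?normr_gt0.
Qed.

Lemma wabs_term_sqr kappa i :
  (Num.sqrt (weight x lambda gamma i) * `|kappa 0 i|) ^+ 2 =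
  weight x lambda gamma i * kappa 0 i ^+ 2.
Proof. by rewrite exprMn sqr_sqrtr ?real_normK ?num_real// ltW ?weight_gt0. Qed.

(** A sum of squares of nonnegative terms is at most the square of their sum. It bounds the step
    size by 1. *)
Lemma weighted_sqr_le_wabs_sum kappa :
  \sum_i weight x lambda gamma i * kappa 0 i ^+ 2 <= wabs_sum kappa ^+ 2.
Proof.
rewrite expr2 {1}/wabs_sum mulr_suml; apply: ler_sum => i _.
rewrite -wabs_term_sqr expr2 ler_wpM2l ?mulr_ge0 ?sqrtr_ge0//.
rewrite /wabs_sum (bigD1 i)//= lerDl.
by apply: sumr_ge0 => j _; rewrite mulr_ge0 ?sqrtr_ge0.
Qed.

Lemma wabs_sum_sqr_le kappa :
  wabs_sum kappa ^+ 2 <=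
  (\sum_i weight x lambda gamma i) * \sum_i kappa 0 i ^+ 2.
Proof.
apply: (le_trans (cauchy_schwarz_sum _ _)).
have E i : Num.sqrt (weight x lambda gamma i) ^+ 2 = weight x lambda gamma i.
  by rewrite sqr_sqrtr// ltW// weight_gt0.
under eq_bigr do rewrite E.
by under [X in _ * X <= _]eq_bigr do rewrite real_normK ?num_real//.
Qed.

Lemma theta_ofE kappa : theta_of x lambda gamma kappa =
  n%:R * lambda ^+ 2 * (\sum_i kappa 0 i ^+ 2) / wabs_sum kappa ^+ 2.
Proof. by rewrite /theta_of wabs_sumE sqr_sumE. Qed.

Lemma sum_weight_gt0 : 0 < \sum_i weight x lambda gamma i.
Proof.
rewrite (bigD1 (Ordinal n_gt0))//= ltr_wpDr ?weight_gt0//.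
by apply: sumr_ge0 => j _; rewrite ltW ?weight_gt0.
Qed.

Lemma theta_star_gt0 : 0 < theta_star x lambda gamma.
Proof. by rewrite divr_gt0 ?sum_weight_gt0// mulr_gt0 ?exprn_gt0. Qed.

Lemma theta_star_le_theta_of kappa : kappa != 0 ->
  theta_star x lambda gamma <= theta_of x lambda gamma kappa.
Proof.
move=> k0; rewrite theta_ofE /theta_star ler_pdivrMr ?sum_weight_gt0//.
rewrite mulrAC ler_pdivlMr ?exprn_gt0 ?wabs_sum_gt0//.
rewrite -[leRHS]mulrA ler_pM2l ?mulr_gt0 ?exprn_gt0// [leRHS]mulrC.
exact: wabs_sum_sqr_le.
Qed.

Lemma theta_of_gt0 kappa : kappa != 0 -> 0 < theta_of x lambda gamma kappa.
Proof. by move=> /theta_star_le_theta_of; apply/lt_le_trans/theta_star_gt0. Qed.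

Lemma theta_of_le1 kappa : kappa != 0 -> theta_of x lambda gamma kappa <= 1.
Proof.
move=> k0; rewrite theta_ofE ler_pdivrMr ?exprn_gt0 ?wabs_sum_gt0// mul1r.
apply: le_trans (weighted_sqr_le_wabs_sum _).
rewrite mulr_sumr; apply: ler_sum => i _.
by rewrite ler_wpM2r ?sqr_ge0// lerDr mulr_ge0 ?vnorm2_ge0.
Qed.

(** An index with nonzero residue adds the positive surplus [vnorm2 x i * gamma * kappa_i^2] to the
    bound behind [theta_of_le1]. Without such a surplus the step size can equal 1, for instance when
    [n = 1] and [x] vanishes. *)
Lemma theta_of_lt1 kappa : kappa != 0 -> 0 < gamma -> (forall i, x i != 0) ->
  theta_of x lambda gamma kappa < 1.
Proof.
move=> k0 g0 x0; rewrite theta_ofE ltr_pdivrMr ?exprn_gt0 ?wabs_sum_gt0// mul1r.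
apply: lt_le_trans (weighted_sqr_le_wabs_sum _).
rewrite -subr_gt0 mulr_sumr -sumrB.
have [i ki] := row_neq0 k0.
have term j : weight x lambda gamma j * kappa 0 j ^+ 2 -
    n%:R * lambda ^+ 2 * kappa 0 j ^+ 2 = vnorm2 x j * gamma * kappa 0 j ^+ 2.
  by rewrite /weight; ring.
under eq_bigr do rewrite term.
have v0 j : 0 < vnorm2 x j.
  rewrite lt_neqAle sqr_ge0 andbT eq_sym; apply/eqP; rewrite /vnorm2 sqr_enorm.
  by move=> /dotp_eq0/eqP; apply/negP/x0.
rewrite (bigD1 i)//= ltr_wpDr//.
  by apply: sumr_ge0 => j _; rewrite mulr_ge0 ?sqr_ge0// mulr_ge0 ?vnorm2_ge0.
by rewrite mulr_gt0 ?exprn_even_gt0// mulr_gt0.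
Qed.

Lemma theta_star_le1 : theta_star x lambda gamma <= 1.
Proof.
(* Any nonzero residue gives a chain through [theta_of]; the all-ones vector is nonzero as [n] is
   positive. *)
have k0 : const_mx 1 != 0 :> 'rV[R]_n.
  apply/eqP => /rowP/(_ (Ordinal n_gt0)); rewrite !mxE.
  by move/eqP; rewrite oner_eq0.
exact: le_trans (theta_star_le_theta_of k0) (theta_of_le1 k0).
Qed.

Lemma potential_ge0 wopt a w : 0 <= potential x phi gamma wopt a w.
Proof. by rewrite addr_ge0// mulr_ge0 ?invr_ge0 ?sqr_ge0. Qed.

(* Where p_i = 0, also kappa_i = 0, so the junk value of 1 / p_i is harmless. *)
Lemma potential_step wopt theta p a w i
    (A := a - alpha_opt x phi wopt) (kappa := residue x phi a w) :
  p 0 i != 0 \/ kappa 0 i = 0 ->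
  p 0 i * potential x phi gamma wopt
    (a - (theta * (p 0 i)^-1 * kappa 0 i) *: delta_mx 0 i)
    (w - (theta * (n%:R * lambda * p 0 i)^-1 * kappa 0 i) *: x i) =
  p 0 i * potential x phi gamma wopt a w
  - 2 * theta * (n%:R^-1 * (kappa 0 i * A 0 i)
       + gamma / lambda * (n%:R^-1 * (kappa 0 i * dotp (x i) (w - wopt))))
  + theta ^+ 2 / (n%:R * lambda) ^+ 2 *
     (weight x lambda gamma i * (kappa 0 i ^+ 2 / p 0 i)).
Proof.
move=> pk; rewrite /potential.
have -> (c : R) : a - c *: delta_mx 0 i - alpha_opt x phi wopt =
    A - c *: delta_mx 0 i.
  by rewrite addrAC.
have -> (c : R) : w - c *: x i - wopt = (w - wopt) - c *: x i by rewrite addrAC.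
rewrite (enorm_subZ_sqr A) (enorm_subZ_sqr (w - wopt)).
rewrite (dotp_delta A) (dotpC _ (x i)).
have -> : enorm (delta_mx 0 i : 'rV[R]_n) ^+ 2 = 1.
  by rewrite sqr_enorm dotp_delta mxE !eqxx.
rewrite -/A -/(vnorm2 x i) /weight.
case: pk => [p0|->]; last by ring.
field.
by rewrite p0 !gt_eqF.
Qed.



Hypothesis phi_diff : forall i (b : R), derivable (phi i) b 1.
Variables (Ls : 'I_n -> R) (wopt : 'rV[R]_d).
Hypothesis gammaE : gamma = gamma_bar Ls.
Hypothesis phi'_lip : forall i (w w' : 'rV[R]_d),
  `|derive1 (phi i) (dotp (x i) w) - derive1 (phi i) (dotp (x i) w')|
  <= Ls i * enorm (w - w').
Hypothesis avg_convex :
  convex_function [set: convex_lmodType 'rV[R]_d] (avg_loss x phi).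
Hypothesis wopt_min :
  forall w, primal x phi lambda wopt <= primal x phi lambda w.

(** Since [w = w_init a], the vector [lambda w] is the average of the [a_i x_i]; thus the average of
    the [kappa_i x_i] is the gradient of the primal objective at [w]. *)
Lemma residue_slope a w u : w = w_init x lambda a ->
  n%:R^-1 * (\sum_i residue x phi a w 0 i * dotp (x i) u) =
  slope x phi w u + lambda * dotp w u.
Proof.
move=> ->; rewrite /slope {3}/w_init dotpC dotpZr dotp_sumr.
rewrite invfM [lambda * _]mulrA [lambda * _]mulrA divff ?gt_eqF// mul1r.
rewrite -mulrDr -big_split; congr (_ * _); apply: eq_bigr => i _ /=.
by rewrite !mxE dotpZr (dotpC u); ring.
Qed.

Lemma residue_slope_ge a w (u := w - wopt) : w = w_init x lambda a ->
  lambda * enorm u ^+ 2 <=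
  n%:R^-1 * (\sum_i residue x phi a w 0 i * dotp (x i) u).
Proof.
by move=> wE; rewrite residue_slope// sqr_enorm; exact: primal_strong_monotone.
Qed.

(** Strong monotonicity forces [w = wopt], and at [wopt] the residue is [a - alpha_opt]. *)
Lemma residue0_potential a w : w = w_init x lambda a ->
  residue x phi a w = 0 -> potential x phi gamma wopt a w = 0.
Proof.
move=> wE k0.
have u0 : w - wopt = 0.
  apply: dotp_eq0; apply/eqP; rewrite eq_le dotp_ge0 andbT.
  have := residue_slope_ge wE.
  rewrite k0 big1 ?mulr0 => [|i _]; last by rewrite mxE mul0r.
  by rewrite pmulr_rle0// sqr_enorm.
have -> : a = alpha_opt x phi wopt.
  apply/rowP => i; have /rowP/(_ i) := k0; rewrite !mxE.
  by move/subr0_eq: u0 => -> /eqP; rewrite addr_eq0 => /eqP.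
have e0 m : enorm (0 : 'rV[R]_m) ^+ 2 = 0.
  by rewrite sqr_enorm -(scale0r 0) dotpZr mul0r.
by rewrite /potential u0 subrr !e0 !mulr0 addr0.
Qed.

Lemma expected_potential_step a w (kappa := residue x phi a w)
    (p := pstar x lambda gamma kappa) (theta := theta_of x lambda gamma kappa) :
  w = w_init x lambda a -> kappa != 0 ->
  \sum_i p 0 i * potential x phi gamma wopt
    (a - (theta * (p 0 i)^-1 * kappa 0 i) *: delta_mx 0 i)
    (w - (theta * (n%:R * lambda * p 0 i)^-1 * kappa 0 i) *: x i)
  <= (1 - theta) * potential x phi gamma wopt a w.
Proof.
move=> wE k0.
set S := wabs_sum kappa; set K := \sum_i kappa 0 i ^+ 2.
pose y i := Num.sqrt (weight x lambda gamma i) * `|kappa 0 i|.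
have S0 : 0 < S by exact: wabs_sum_gt0.
have pE i : p 0 i = y i / S by rewrite mxE wabs_sumE.
have y0 i : kappa 0 i != 0 -> y i != 0.
  by move=> ki; rewrite mulf_neq0 ?normr_eq0// sqrtr_eq0 -ltNge weight_gt0.
have p0 i : p 0 i != 0 \/ kappa 0 i = 0.
  case: (eqVneq (kappa 0 i) 0) => ki; [by right|left].
  by rewrite pE mulf_neq0 ?invr_eq0 ?y0// gt_eqF.
(* The probabilities are proportional to [y i], so the second-order terms sum to [S * S]. *)
have kp i : weight x lambda gamma i * (kappa 0 i ^+ 2 / p 0 i) = S * y i.
  rewrite mulrA -wabs_term_sqr pE -/(y i).
  have [ki|ki] := eqVneq (kappa 0 i) 0.
    by rewrite /y ki normr0 mulr0 expr0n !mul0r mulr0.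
  by field; rewrite y0// gt_eqF.
have p1 : \sum_i p 0 i = 1.
  by under eq_bigr do rewrite pE; rewrite -mulr_suml divff// gt_eqF.
under eq_bigr do rewrite (potential_step _ _ (p0 _)) kp.
set A := a - alpha_opt x phi wopt; set u := w - wopt.
set D := potential x phi gamma wopt a w.
rewrite big_split sumrB -!mulr_suml -!mulr_sumr p1 mul1r big_split /=.
rewrite -!mulr_sumr -[\sum_i y i]/S.
(* The step size is chosen so that the second-order term in [theta ^+ 2] becomes linear in [theta],
   with coefficient [K / n]. *)
have thetaE : theta * S ^+ 2 = n%:R * lambda ^+ 2 * K.
  by rewrite /theta theta_ofE divfK// expf_neq0// gt_eqF.
have -> : theta ^+ 2 / (n%:R * lambda) ^+ 2 * (S * S) = theta * (n%:R^-1 * K).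
  rewrite -expr2.
  transitivity (theta / (n%:R * lambda) ^+ 2 * (theta * S ^+ 2)).
    by ring.
  by rewrite thetaE; field; rewrite !gt_eqF.
have G := residue_slope_ge wE; rewrite -/kappa -/u in G.
set X := \sum_i kappa 0 i * dotp _ _ in G *.
pose B2 := \sum_i (kappa 0 i - A 0 i) ^+ 2.
have B2E : B2 = K - 2 * (\sum_i kappa 0 i * A 0 i) + \sum_i A 0 i ^+ 2.
  rewrite mulr_sumr -sumrB -big_split; apply: eq_bigr => i _ /=; ring.
(* The value of [gamma], the mean of the squared constants, is chosen for this bound. *)
have B2le : n%:R^-1 * B2 <= gamma * enorm u ^+ 2.
  rewrite gammaE /gamma_bar -mulrA ler_wpM2l ?invr_ge0// mulr_suml.
  apply: ler_sum => i _; rewrite -exprMn -real_normK ?num_real//.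
  have l0 := phi'_lip i w wopt.
  have -> : kappa 0 i - A 0 i =
      derive1 (phi i) (dotp (x i) w) - derive1 (phi i) (dotp (x i) wopt).
    by rewrite !mxE; ring.
  by rewrite ler_pXn2r// nnegrE// (le_trans _ l0).
have DE : D = n%:R^-1 * (\sum_i A 0 i ^+ 2) + gamma * enorm u ^+ 2.
  rewrite /D /potential sqr_enorm; congr (_ * _ + _).
have th0 : 0 <= theta by rewrite ltW// theta_of_gt0.
have G' : gamma * enorm u ^+ 2 <= gamma / lambda * (n%:R^-1 * X).
  by rewrite -mulrA ler_wpM2l// ler_pdivlMl.
rewrite -subr_ge0.
(* The terms in [K] cancel. Of the two copies of [gamma * enorm u ^+ 2] supplied by [G'], one pays
   for [B2] and one for the primal part of [D]. *)
have -> : (1 - theta) * D - (D - 2 * theta *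
     (n%:R^-1 * (\sum_i kappa 0 i * A 0 i) + gamma / lambda * (n%:R^-1 * X)) +
     theta * (n%:R^-1 * K)) =
   theta * (2 * (gamma / lambda * (n%:R^-1 * X)) - n%:R^-1 * B2 -
            gamma * enorm u ^+ 2).
  by rewrite DE B2E; ring.
rewrite mulr_ge0//; lra.
Qed.

Lemma expected_potential_le a w (kappa := residue x phi a w)
    (p := pstar x lambda gamma kappa) (theta := theta_of x lambda gamma kappa) :
  w = w_init x lambda a -> kappa != 0 ->
  \sum_i p 0 i * potential x phi gamma wopt
    (a - (theta * (p 0 i)^-1 * kappa 0 i) *: delta_mx 0 i)
    (w - (theta * (n%:R * lambda * p 0 i)^-1 * kappa 0 i) *: x i)
  <= (1 - theta_star x lambda gamma) * potential x phi gamma wopt a w.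
Proof.
move=> wE k0; apply: le_trans (expected_potential_step wE k0) _.
rewrite ler_wpM2r ?potential_ge0// lerD2l lerN2.
exact: theta_star_le_theta_of.
Qed.

End Step.

(** * Integrals of functions of a finitely valued random element *)

Section FiniteValued.
Context (R : realType) (dsp : measure_display) (Omega : measurableType dsp).
Variables (P : probability Omega R) (T : finType) (Y : Omega -> T).
Hypothesis mY : forall t, measurable (Y @^-1` [set t]).

Lemma measurable_fiber_pred (A : pred T) : measurable [set o | A (Y o)].
Proof.
have -> : [set o | A (Y o)] = \big[setU/set0]_(t | A t) (Y @^-1` [set t]).
  rewrite -bigcup_seq_cond; apply/seteqP.
  split => /= [u Ao|o [t /andP[_ At] oE]]; last by rewrite /= oE.
  by exists (Y u) => //=; rewrite mem_index_enum.
by apply: bigsetU_measurable => t _; exact: mY.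
Qed.

(** [F (Y o)] is a finite combination of indicators of fibers; nonnegativity of [F] lets the sum and
    the integral be exchanged. *)
Lemma integral_fiber (A : pred T) (F : T -> R) : (forall t, 0 <= F t) ->
  (\int[P]_(o in [set o | A (Y o)]) (F (Y o))%:E =
   (\sum_(t | A t) F t * fine (P (Y @^-1` [set t])))%:E)%E.
Proof.
move=> F0; have mA := measurable_fiber_pred A.
have YE o : (F (Y o))%:E = (\sum_t (F t)%:E * (\1_(Y @^-1` [set t]) o)%:E)%E.
  rewrite (bigD1 (Y o))//= big1 ?adde0 => [|t tY].
    by rewrite indicE mem_set// mule1.
  rewrite indicE memNset ?mule0//= => tE.
  by rewrite -tE eqxx in tY.
under eq_integral do rewrite YE.
have mI t : measurable_fun [set: Omega]
    (EFin \o (\1_(Y @^-1` [set t]) : Omega -> R)).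
  by apply/measurable_EFinP; exact: measurable_indic.
rewrite ge0_integral_sum//; last 2 first.
- move=> t; apply: measurable_funeM; apply: measurable_funS (mI t) => //.
- by move=> t o _; rewrite mule_ge0 ?lee_fin.
rewrite -sumEFin [RHS]big_mkcond; apply: eq_bigr => t _.
rewrite ge0_integralZl_EFin//; last exact: measurable_funS (mI t).
rewrite integral_indic//; case: ifPn => At.
  rewrite EFinM fineK ?fin_num_measure//; congr (_ * P _)%E.
  by apply/seteqP; split => /= u; [by case|move=> Yu; split => //=; rewrite Yu].
rewrite (_ : _ `&` _ = set0) ?measure0 ?mule0//.
by apply/seteqP; split => // u [/= Yu]; rewrite Yu (negbTE At).
Qed.

End FiniteValued.

(** * Iterates as functions of the sampled indices *)

Section Run.
Context (R : realType) (n d : nat).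
Variables (x : 'I_n -> 'rV[R]_d) (phi : 'I_n -> R -> R).
Variables (lambda gamma : R) (alpha0 : 'rV[R]_n).
Hypotheses (lambda_gt0 : 0 < lambda) (gamma_ge0 : 0 <= gamma).
Hypothesis n_gt0 : (0 < n)%N.

Definition adf_step (s : 'rV[R]_n * 'rV[R]_d) (i : 'I_n) :=
  let kappa := residue x phi s.1 s.2 in
  let p := pstar x lambda gamma kappa in
  let theta := theta_of x lambda gamma kappa in
  (s.1 - (theta * (p 0 i)^-1 * kappa 0 i) *: delta_mx 0 i,
   s.2 - (theta * (n%:R * lambda * p 0 i)^-1 * kappa 0 i) *: x i).

Definition adf_state (h : seq 'I_n) : 'rV[R]_n * 'rV[R]_d :=
  foldl adf_step (alpha0, w_init x lambda alpha0) h.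

Lemma adf_step0 s i : residue x phi s.1 s.2 = 0 -> adf_step s i = s.
Proof.
case: s => a w /= k0; rewrite /adf_step /=.
have -> : residue x phi a w 0 i = 0 by rewrite k0 mxE.
by rewrite !mulr0 !scale0r !subr0.
Qed.

Lemma w_initB a c i :
  w_init x lambda (a - c *: delta_mx 0 i) =
  w_init x lambda a - ((lambda * n%:R)^-1 * c) *: x i.
Proof.
rewrite /w_init -scalerA -scalerBr; congr (_ *: _).
have -> : c *: x i = \sum_j (c *: delta_mx 0 i : 'rV[R]_n) 0 j *: x j.
  rewrite (bigD1 i)//= big1 => [|j ji]; rewrite !mxE ?eqxx ?mulr1 ?addr0//=.
  by rewrite (negbTE ji) mulr0 scale0r.
by rewrite -sumrB; apply: eq_bigr => j _; rewrite !mxE scalerBl.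
Qed.

(** The invariant linking primal and dual iterates: by [w_initB] the dual update shifts [w_init] by
    exactly the primal update. *)
Lemma adf_state_w h : (adf_state h).2 = w_init x lambda (adf_state h).1.
Proof.
elim/last_ind: h => [//|h i IH].
rewrite /adf_state -cats1 foldl_cat /= -/(adf_state h) w_initB -IH.
congr (_ - _ *: _); rewrite (mulrC lambda) invfM; ring.
Qed.

(** * Expectations along a random run *)

Section Sampling.
Context (dsp : measure_display) (Omega : measurableType dsp).
Variables (P : probability Omega R).
Variables (idx : nat -> Omega -> 'I_n) (p : nat -> Omega -> 'rV[R]_n)
  (theta : nat -> Omega -> R) (alpha : nat -> Omega -> 'rV[R]_n)
  (w : nat -> Omega -> 'rV[R]_d).
Hypothesis run : adfSDCA_run x phi lambda P alpha0 idx p theta alpha w.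
Let kappa t o := residue x phi (alpha t o) (w t o).
Hypothesis p_opt :
  forall t o, kappa t o != 0 -> p t o = pstar x lambda gamma (kappa t o).
Hypothesis theta_opt :
  forall t o, kappa t o != 0 -> theta t o = theta_of x lambda gamma (kappa t o).

(** Encoded as a tuple so that its values form a finite type, as [integral_fiber] requires. *)
Definition history t o : t.-tuple 'I_n := [tuple of mkseq (idx^~ o) t].

(* Holds also where kappa = 0 and p, theta are unconstrained: then no update
   takes place. *)
Lemma run_state t o : (alpha t o, w t o) = adf_state (history t o).
Proof.
elim: t => [|t IH]; first by rewrite (adf_alpha0 run) (adf_w0 run).
rewrite /= mkseqS /adf_state -cats1 foldl_cat /=.
rewrite -/(adf_state (history t o)) -IH.
rewrite (adf_alphaS run) (adf_wS run).
have [k0|k0] := eqVneq (kappa t o) 0.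
  have -> : residue x phi (alpha t o) (w t o) 0 (idx t o) = 0.
    by rewrite -/(kappa t o) k0 mxE.
  by rewrite adf_step0// !mulr0 !scale0r !subr0.
by rewrite /adf_step /= -/(kappa t o) p_opt// theta_opt.
Qed.

Lemma history_fiber t o :
  history t @^-1` [set history t o] =
  [set o' | forall s, (s < t)%N -> idx s o' = idx s o].
Proof.
apply/seteqP; split => o' /=.
  move=> /(congr1 val)/= hE s st.
  have := congr1 (fun h => nth (idx s o) h s) hE.
  by rewrite !nth_mkseq.
move=> hE; apply: val_inj => /=; apply: (@eq_from_nth _ (idx 0%N o)).
  by rewrite !size_mkseq.
by move=> s; rewrite size_mkseq => st; rewrite !nth_mkseq// hE.
Qed.

Lemma measurable_history t h : measurable (history t @^-1` [set h]).
Proof.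
have -> : history t @^-1` [set h] =
    \bigcap_(s in [set: 'I_t]) idx s @^-1` [set tnth h s].
  apply/seteqP; split => o /=.
    by move=> <- s _ /=; rewrite (tnth_nth (idx s o)) /= nth_mkseq.
  move=> oh; apply: eq_from_tnth => s; have <- := oh s I.
  by rewrite (tnth_nth (idx s o)) /= nth_mkseq.
apply: fin_bigcap_measurable => [|s _]; first exact: finite_finset.
exact: (adf_measurable run).
Qed.

(** The next state is a function of this pair; keeping its components apart allows summing over the
    new index with the past fixed. *)
Definition past_and_sample t o := (history t o, idx t o).

Lemma past_and_sample_fiber t y : past_and_sample t @^-1` [set y] =
  history t @^-1` [set y.1] `&` idx t @^-1` [set y.2].
Proof.
case: y => h i; apply/seteqP; split => o /=; first by case=> -> ->.
by case=> <- <-.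
Qed.

Lemma measurable_past_and_sample t y :
  measurable (past_and_sample t @^-1` [set y]).
Proof.
rewrite past_and_sample_fiber; apply: measurableI.
  exact: measurable_history.
exact: (adf_measurable run).
Qed.

Lemma state_past_and_sample t o :
  (alpha t.+1 o, w t.+1 o) =
  adf_step (adf_state (past_and_sample t o).1) (past_and_sample t o).2.
Proof.
by rewrite run_state /= mkseqS /adf_state -cats1 foldl_cat.
Qed.

Hypothesis phi_diff : forall i (b : R), derivable (phi i) b 1.
Variables (Ls : 'I_n -> R) (wopt : 'rV[R]_d).
Hypothesis gammaE : gamma = gamma_bar Ls.
Hypothesis phi'_lip : forall i (w w' : 'rV[R]_d),
  `|derive1 (phi i) (dotp (x i) w) - derive1 (phi i) (dotp (x i) w')|
  <= Ls i * enorm (w - w').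
Hypothesis avg_convex :
  convex_function [set: convex_lmodType 'rV[R]_d] (avg_loss x phi).
Hypothesis wopt_min :
  forall w, primal x phi lambda wopt <= primal x phi lambda w.

Let pot (s : 'rV[R]_n * 'rV[R]_d) : R := potential x phi gamma wopt s.1 s.2.
Let rate : R := 1 - theta_star x lambda gamma.
Let past_prob t (h : t.-tuple 'I_n) : R := fine (P (history t @^-1` [set h])).

Lemma sampled_potential_le t (h : t.-tuple 'I_n) :
  \sum_i pot (adf_step (adf_state h) i) *
     fine (P (past_and_sample t @^-1` [set (h, i)])) <=
  rate * pot (adf_state h) * past_prob h.
Proof.
have mh := measurable_history h.
(* On a null history both sides are 0, since each joint event is contained in it. *)
have [q0|q0] := eqVneq (P (history t @^-1` [set h])) 0%E.
  rewrite /past_prob q0 mulr0 big1// => i _.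
  rewrite (_ : P _ = 0%E) ?mulr0//; apply/eqP.
  rewrite -measure_le0 -q0 past_and_sample_fiber /=.
  apply: le_measure; rewrite ?inE//.
  by apply: measurableI => //; exact: (adf_measurable run).
(* The sampling law is stated at outcomes, so a history of positive probability must first be
   realized by one. *)
have [u hE] : exists u, history t u = h.
  apply: contrapT => no; move/negP: q0; apply.
  rewrite (_ : _ @^-1` _ = set0) ?measure0//.
  by apply/seteqP; split => // o /= oh; apply: no; exists o.
have sE : adf_state h = (alpha t u, w t u) by rewrite run_state hE.
have PE i : fine (P (past_and_sample t @^-1` [set (h, i)])) =
    past_prob h * p t u 0 i.
  rewrite past_and_sample_fiber/= /past_prob -hE history_fiber.
  rewrite (adf_sampling run t u i) -history_fiber hE.
  by rewrite -{1}(fineK (fin_num_measure P _ mh)) -EFinM.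
under eq_bigr do rewrite PE mulrCA.
rewrite -mulr_sumr [leRHS]mulrC ler_wpM2l ?fine_ge0//.
have [p0 p1] := adf_prob run t u.
have [k0|k0] := eqVneq (kappa t u) 0.
  have pot0 : pot (adf_state h) = 0.
    apply: (residue0_potential gamma lambda_gt0 phi_diff avg_convex wopt_min).
      exact: adf_state_w.
    by rewrite sE.
  rewrite pot0 mulr0 big1// => i _.
  by rewrite adf_step0 ?sE// -sE pot0 mul0r.
rewrite (p_opt k0).
have wE : w t u = w_init x lambda (alpha t u).
  by have := adf_state_w h; rewrite sE.
have := expected_potential_le lambda_gt0 gamma_ge0 n_gt0 phi_diff gammaE
  phi'_lip avg_convex wopt_min wE k0.
rewrite sE; apply: le_trans.
by apply: ler_sum => i _; rewrite mulrC.
Qed.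

Lemma integral_history t (F : 'rV[R]_n * 'rV[R]_d -> R) :
  (forall s, 0 <= F s) ->
  (\int[P]_o (F (alpha t o, w t o))%:E =
   (\sum_(h : t.-tuple 'I_n) F (adf_state h) * past_prob h)%:E)%E.
Proof.
move=> F0.
have := integral_fiber P (@measurable_history t) xpredT
  (fun h : t.-tuple 'I_n => F0 (adf_state h)).
have -> : [set o | xpredT (history t o)] = setT by apply/seteqP; split.
move=> <-.
by apply: eq_integral => o _; rewrite run_state.
Qed.

(** The set [A] serves two uses: all histories for the unconditional recursion, and the histories
    leading to a given dual iterate for the conditional bound. *)
Lemma integral_next_potential t (A : pred (t.-tuple 'I_n)) :
  (\int[P]_(o in [set o | A (history t o)]) (pot (alpha t.+1 o, w t.+1 o))%:E <=
   (\sum_(h | A h) rate * pot (adf_state h) * past_prob h)%:E)%E.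
Proof.
pose G (y : t.-tuple 'I_n * 'I_n) := pot (adf_step (adf_state y.1) y.2).
have G0 y : 0 <= G y by apply: potential_ge0.
have := integral_fiber P (@measurable_past_and_sample t) (fun y => A y.1) G0.
under eq_integral do rewrite /G -state_past_and_sample.
move=> ->; rewrite lee_fin.
have -> : \sum_(y | A y.1) G y * fine (P (past_and_sample t @^-1` [set y])) =
    \sum_(h | A h) \sum_i
      G (h, i) * fine (P (past_and_sample t @^-1` [set (h, i)])).
  by rewrite pair_big; apply: eq_big => [[h i]|[h i] _]//=; rewrite andbT.
by apply: ler_sum => h _; exact: sampled_potential_le.
Qed.

Lemma cond_potential_le t o :
  (cond_expectation P (fun o => pot (alpha t.+1 o, w t.+1 o)) (alpha t) o <=
   (rate * pot (alpha t o, w t o))%:E)%E.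
Proof.
(* Conditioning on the dual iterate is coarser than on the history: several histories may reach the
   same [alpha]. They share [w] by the invariant, hence also the potential. *)
pose A (h : t.-tuple 'I_n) := (adf_state h).1 == alpha t o.
have AE : alpha t @^-1` [set alpha t o] = [set o' | A (history t o')].
  apply/seteqP; split => o' /=; rewrite /A -run_state /=; first by move=> ->.
  by move/eqP.
have potE h : A h -> pot (adf_state h) = pot (alpha t o, w t o).
  move=> /eqP Ah; rewrite /pot /= adf_state_w Ah.
  have [<- <-] : (adf_state (history t o)).1 = alpha t o /\
      (adf_state (history t o)).2 = w t o by rewrite -run_state.
  by rewrite adf_state_w.
have PA : P (alpha t @^-1` [set alpha t o]) = (\sum_(h | A h) past_prob h)%:E.
  have := integral_fiber P (@measurable_history t) A (fun=> ler01).
  rewrite integral_cst.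
    rewrite mul1e -AE => ->; congr (_%:E).
    by apply: eq_bigr => h _; rewrite mul1r.
  exact: measurable_fiber_pred (@measurable_history t) A.
have := integral_next_potential A.
rewrite /cond_expectation AE -AE PA /= AE.
set Q := \sum_(h | A h) past_prob h.
have -> : \sum_(h | A h) rate * pot (adf_state h) * past_prob h =
    rate * pot (alpha t o, w t o) * Q.
  by rewrite mulr_sumr; apply: eq_bigr => h Ah; rewrite potE.
have Q0 : 0 <= Q by apply: sumr_ge0 => h _; rewrite fine_ge0.
move=> IQ; have := @lee_wpmul2l R Q^-1%:E _ _ _ IQ.
rewrite lee_fin invr_ge0 => /(_ Q0)/le_trans; apply.
(* If the conditioning event is null, the factor [Q^-1] is 0 by convention and nonnegativity of the
   right-hand side suffices. *)
rewrite -EFinM lee_fin; have [->|Qn0] := eqVneq Q 0.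
  rewrite invr0 mul0r mulr_ge0 ?potential_ge0//.
  by rewrite subr_ge0 theta_star_le1.
by rewrite mulrCA mulVf// mulr1.
Qed.

Lemma expected_potential_geometric t :
  (\int[P]_o (pot (alpha t o, w t o))%:E <=
   (rate ^+ t * pot (alpha0, w_init x lambda alpha0))%:E)%E.
Proof.
have rate0 : 0 <= rate by rewrite subr_ge0 theta_star_le1.
elim: t => [|t IH].
  under eq_integral do rewrite (adf_alpha0 run) (adf_w0 run).
  rewrite integral_cst// expr0 mul1r.
  rewrite [X in (_ * X)%E](_ : _ = 1%E) ?mule1//; exact: probability_setT.
have := @integral_next_potential t xpredT.
have -> : [set o | xpredT (history t o)] = setT by apply/seteqP; split.
move=> /le_trans; apply.
rewrite exprS -mulrA EFinM.
under eq_bigr do rewrite -mulrA.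
rewrite -mulr_sumr EFinM lee_wpmul2l//.
by rewrite -(integral_history t (F := pot))// => s; exact: potential_ge0.
Qed.

Lemma expected_primal_gap T :
  (forall i, smooth (Ls i) (fun w => phi i (dotp (x i) w))) -> 0 < gamma ->
  ('E_P[(fun o => primal x phi lambda (w T o) - primal x phi lambda wopt)%R] <=
   ((lambda + Lmax Ls) / (2 * gamma) *
     (rate ^+ T * pot (alpha0, w_init x lambda alpha0)))%:E)%E.
Proof.
move=> sm g0.
have L0 : 0 <= Lmax Ls by exact: bigmax_ge_id.
set C := _ / (2 * gamma).
have C0 : 0 <= C by rewrite divr_ge0 ?mulr_ge0 ?addr_ge0// ltW.
(* The dual part of the potential is dropped; dividing by [gamma] requires it to be positive. *)
have gap s : primal x phi lambda s.2 - primal x phi lambda wopt <= C * pot s.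
  apply: (le_trans (primal_gap phi_diff _ n_gt0 sm wopt_min)).
  have -> : (lambda + Lmax Ls) / 2 * enorm (s.2 - wopt) ^+ 2 =
      C * (gamma * enorm (s.2 - wopt) ^+ 2).
    by rewrite /C; field; rewrite gt_eqF.
  by rewrite ler_wpM2l// lerDr mulr_ge0 ?invr_ge0 ?sqr_ge0.
rewrite unlock.
have := @integral_history T
  (fun s => primal x phi lambda s.2 - primal x phi lambda wopt).
move=> ->; last by move=> s; rewrite subr_ge0.
apply: (@le_trans _ _ (C%:E * \int[P]_o (pot (alpha T o, w T o))%:E)%E).
  rewrite integral_history => [|s]; last exact: potential_ge0.
  rewrite -EFinM lee_fin mulr_sumr; apply: ler_sum => h _.
  by rewrite mulrA ler_wpM2r ?fine_ge0.
by rewrite [leRHS]EFinM lee_wpmul2l//; exact: expected_potential_geometric.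
Qed.

End Sampling.
End Run.

(** * From the contraction factor to an iteration count *)

Lemma theta_starV (R : realType) (n d : nat) (x : 'I_n -> 'rV[R]_d)
    (lambda gamma : R) : 0 < lambda -> (0 < n)%N ->
  (theta_star x lambda gamma)^-1 = n%:R + gamma * Qavg x / lambda ^+ 2.
Proof.
move=> l0 n0; have nn : (n%:R : R) != 0 by rewrite pnatr_eq0 -lt0n.
rewrite /theta_star /Qavg /weight invf_div big_split/= sumr_const card_ord.
by rewrite -mulr_suml -[X in _ + X]mulr_natl; field; rewrite nn gt_eqF.
Qed.

(** Uses [1 - th <= exp (- th)]. The case [K = 0] is separate because [expR] inverts [ln] only at
    positive arguments. *)
Lemma geometric_le_ln (R : realType) (th K eps : R) (T : nat) :
  0 < eps -> 0 <= K -> 0 < th -> th <= 1 ->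
  th^-1 * ln (K / eps) <= T%:R -> (1 - th) ^+ T * K <= eps.
Proof.
move=> eps0 K0 th0 th1 T_ge.
have [<-|Kn0] := eqVneq 0 K; first by rewrite mulr0 ltW.
have Kgt0 : 0 < K by rewrite lt_neqAle Kn0.
have r0 : 0 < K / eps by rewrite divr_gt0.
rewrite -ler_pdivlMr//.
have -> : eps / K = expR (- ln (K / eps)).
  by rewrite expRN lnK ?posrE// invf_div.
apply: (@le_trans _ _ (expR (- th) ^+ T)).
  rewrite lerXn2r ?nnegrE ?subr_ge0 ?expR_ge0//.
  exact: expR_ge1Dx.
by rewrite -expRM_natl ler_expR mulrN lerN2 [_ * th]mulrC -ler_pdivrMl.
Qed.

Theorem theorem2 (R : realType) (n d : nat) (n_gt0 : (0 < n)%N)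
    (x : 'I_n -> 'rV[R]_d) (phi : 'I_n -> R -> R)
    (lambda : R) (lambda_gt0 : 0 < lambda)
    (phi_diff : forall i (b : R), derivable (phi i) b 1)
    (Lt : 'I_n -> R) (Lt_gt0 : forall i, 0 < Lt i)
    (phi_smooth : forall i b dl,
       `|derive1 (phi i) b - derive1 (phi i) (b + dl)| <= Lt i * `|dl|)
    (Ls : 'I_n -> R)
    (loss_smooth : forall i, smooth (Ls i) (fun w => phi i (dotp (x i) w)))
    (Ls_le : forall i, Ls i <= enorm (x i) ^+ 2 * Lt i)
    (* not implied by loss_smooth when |x_i| < 1: the result fails without it *)
    (phi'_lip : forall i (w w' : 'rV[R]_d),
       `|derive1 (phi i) (dotp (x i) w) - derive1 (phi i) (dotp (x i) w')|
         <= Ls i * enorm (w - w'))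
    (avg_convex : convex_function [set: convex_lmodType 'rV[R]_d]
                    (avg_loss x phi))
    (wopt : 'rV[R]_d)
    (wopt_min : forall w, primal x phi lambda wopt <= primal x phi lambda w)
    (dsp : measure_display) (Omega : measurableType dsp)
    (P : probability Omega R)
    (alpha0 : 'rV[R]_n) (idx : nat -> Omega -> 'I_n)
    (p : nat -> Omega -> 'rV[R]_n) (theta : nat -> Omega -> R)
    (alpha : nat -> Omega -> 'rV[R]_n) (w : nat -> Omega -> 'rV[R]_d)
    (run : adfSDCA_run x phi lambda P alpha0 idx p theta alpha w)
    (gamma := gamma_bar Ls)
    (kappa := fun t o => residue x phi (alpha t o) (w t o))
    (p_opt : forall t o, kappa t o != 0 ->
       p t o = pstar x lambda gamma (kappa t o))
    (theta_opt : forall t o, kappa t o != 0 ->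
       theta t o = theta_of x lambda gamma (kappa t o))
    (D := fun t o => potential x phi gamma wopt (alpha t o) (w t o))
    (C0 := potential x phi gamma wopt alpha0 (w_init x lambda alpha0)) :
  [/\ forall t, {ae P, forall o,
        (cond_expectation P (D t.+1) (alpha t) o <=
         ((1 - theta_star x lambda gamma) * D t o)%:E)%E},
      forall t o, kappa t o != 0 ->
        [/\ theta_star x lambda gamma <= theta t o,
            0 < theta t o <= 1 &
            0 < gamma -> (forall i, x i != 0) -> theta t o < 1] &
      forall (eps : R) (T : nat), 0 < eps -> 0 < gamma ->
        (n%:R + gamma * Qavg x / lambda ^+ 2) *
          ln ((lambda + Lmax Ls) * C0 / (2 * gamma * eps)) <= T%:R ->
        ('E_P[(fun o => primal x phi lambda (w T o) - primal x phi lambda wopt)%R]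
           <= eps%:E)%E].

Proof.
have gamma0 : 0 <= gamma.
  by rewrite mulr_ge0 ?invr_ge0//; apply: sumr_ge0 => i _; exact: sqr_ge0.
split.
(* The bound holds at every outcome, including those in null conditioning events. *)
- move=> t; apply/aeW => o.
  exact: (cond_potential_le lambda_gt0 gamma0 n_gt0 run p_opt theta_opt
    phi_diff (erefl gamma) phi'_lip avg_convex wopt_min).
- move=> t o k0; rewrite theta_opt//; split.
  + exact: theta_star_le_theta_of.
  + by rewrite theta_of_gt0// theta_of_le1.
  + exact: theta_of_lt1.
- move=> eps T eps0 g0 T_ge.
  have gap := expected_primal_gap lambda_gt0 gamma0 n_gt0 run p_opt theta_opt
    phi_diff (erefl gamma) phi'_lip avg_convex wopt_min T loss_smooth g0.
  apply: (le_trans gap).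
  rewrite lee_fin mulrCA; apply: geometric_le_ln => //.
  + rewrite mulr_ge0 ?potential_ge0// divr_ge0 ?(mulr_ge0 (ler0n _ 2) gamma0)//.
    by rewrite addr_ge0 ?bigmax_ge_id// ltW.
  + exact: theta_star_gt0.
  + exact: theta_star_le1.
  + rewrite theta_starV// [_ / eps](_ : _ =
      (lambda + Lmax Ls) * C0 / (2 * gamma * eps))//.
    by rewrite /C0 /=; field; rewrite !gt_eqF.
Qed.
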